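(* Let $X$ be a finite pure $d$-dimensional simplicial complex. If $H_d(X,B(X);\mathbb{R})\neq 0$, then $$\min_{\sigma\in X_d}|\sigma_{d-1}\cap B(X)_{d-1}|\ \le\ \mu_d(X)\ \le\ \max_{\sigma\in X_d}|\sigma_{d-1}\cap B(X)_{d-1}|.$$
   Context: A simplicial complex $X$ is a finite collection of finite sets closed under taking subsets, always containing $\emptyset$; $\dim\sigma=|\sigma|-1$; $X_k$ is the set of $k$-dimensional faces; $V(X)$ is the union of all faces. $X$ is pure if all its inclusion-maximal faces have the same dimension. For $\sigma\in X_k$: $\deg_X(\sigma)=|\{\eta\in X_{k+1}:\sigma\subseteq\eta\}|$ and $\sigma_{k-1}=\{\tau\in X_{k-1}:\tau\subseteq\sigma\}$. For $X$ of dimension $d$, $$B(X)=\{\sigma\in X:\sigma\subseteq\tau\text{ for some }\tau\in X_{d-1}\text{ with }\deg_X(\tau)\le 1\},$$ and $B(X)_{d-1}$ is its set of $(d-1)$-dimensional faces (if no such $\tau$ exists, $B(X)$ is empty and contributes no chains). Fix a total order on $V(X)$. $C_k(X;\mathbb{R})$ is the real vector space with basis $X_k$ ($k\ge -1$), and $\partial_k[\sigma]=\sum_{i=0}^k(-1)^i[\sigma\setminus\{v_i\}]$ for $\sigma=\{v_0\prec\dots\prec v_k\}$. With adjoints (transposes) in these bases, $L_k(X)=\partial_{k+1}\partial_{k+1}^*+\partial_k^*\partial_k$, and $\mu_k(X)$ is its smallest eigenvalue. For a subcomplex $A$, $H_k(X,A;\mathbb{R})$ is the homology of the quotient complex $C_k(X;\mathbb{R})/C_k(A;\mathbb{R})$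 with the induced boundary maps. *)

(* Defs.v *)
From HB Require Import structures.
From mathcomp Require Import all_boot all_order all_algebra.
From mathcomp Require Import classical_sets reals.

Set Implicit Arguments.
Unset Strict Implicit.
Unset Printing Implicit Defensive.

Import Order.TTheory GRing.Theory Num.Theory.

Local Open Scope ring_scope.

Section Complexes.

Context {disp : Order.disp_t} {T : finOrderType disp}.
Implicit Types (X A : {set {set T}}) (s t : {set T}) (k l : int).

Definition simplicial_complex X : Prop :=
  finset.set0 \in X /\ forall s t, s \in X -> t \subset s -> t \in X.

(* Dimensions are integers, so that the empty face, of
   dimension -1, needs no special treatment. *)
Definition dim s : int := #|s|%:Z - 1.

Definition cdim X : int := (\max_(s in X) #|s|)%N%:Z - 1.

Definition faces X k : {set {set T}} := [set s in X | dim s == k].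

Definition facets X : {set {set T}} := [set s | maxset (mem X) s].

Definition pure X : Prop := {in facets X &, forall s t, dim s = dim t}.

Definition deg X s : nat := #|[set t in faces X (dim s + 1) | s \subset t]|.

Definition boundary_faces X s : {set {set T}} :=
  [set t in faces X (dim s - 1) | t \subset s].

Definition bd_complex X : {set {set T}} :=
  [set s in X |
    [exists t in faces X (cdim X - 1), (deg X t <= 1)%N && (s \subset t)]].

(* The maximum is used as the default value of the iterated minimum: it is
   neutral for the values that occur. *)
Definition min_over (S : {set {set T}}) (f : {set T} -> nat) : nat :=
  \big[minn / (\max_(s in S) f s)%N]_(s in S) f s.

Section Chains.

Variable R : realType.

(* Coefficient of [t] in the boundary of [s]. If v is the i-th vertex of s in
   increasing order, counting from 0, then i is the number of vertices of s
   smaller than v. *)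
Definition incidence s t : R :=
  \sum_(v in s | t == s :\ v) (-1) ^+ #|[set w in s | (w < v)%O]|.

(* The k-chains are the column vectors with coordinates indexed by [faces X k].
   [bdry X k (k - 1)] is the matrix of the k-th boundary map. The degree l of
   the target is a separate argument because k + 1 - 1 is not convertible to
   k; the only meaningful value is l = k - 1. *)
Definition bdry X k l : 'M[R]_(#|faces X l|, #|faces X k|) :=
  \matrix_(i, j) incidence (enum_val j) (enum_val i).

Definition laplacian X k : 'M[R]_#|faces X k| :=
  bdry X (k + 1) k *m (bdry X (k + 1) k)^T
  + (bdry X k (k - 1))^T *m bdry X k (k - 1).

(* A least eigenvalue exists when A is symmetric of positive size; the value
   is 0 when there is none. *)
Definition smallest_eigenvalue n (A : 'M[R]_n) : R :=
  xget 0 [set a | eigenvalue A a /\ forall b, eigenvalue A b -> a <= b]%classic.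

Definition mu X k : R := smallest_eigenvalue (laplacian X k).

Definition chain_in X A k (c : 'cV[R]_#|faces X k|) : Prop :=
  forall i, enum_val i \notin A -> c i 0 = 0.

(* The class of c in C_k(X)/C_k(A) is a cycle, resp. a boundary, of the
   quotient complex. *)
Definition rel_cycle X A k (c : 'cV[R]_#|faces X k|) : Prop :=
  chain_in A (bdry X k (k - 1) *m c).

Definition rel_boundary X A k (c : 'cV[R]_#|faces X k|) : Prop :=
  exists b : 'cV[R]_#|faces X (k + 1)|, chain_in A (c - bdry X (k + 1) k *m b).

(* H_k(X, A; R) <> 0: some cycle of C(X)/C(A) is not a boundary there. *)
Definition rel_homology_neq0 X A k : Prop :=
  exists c : 'cV[R]_#|faces X k|, rel_cycle A c /\ ~ rel_boundary A c.

End Chains.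

End Complexes.

(* Main.v *)
Require Import Defs.
From mathcomp Require Import all_boot all_order all_algebra.
From mathcomp Require Import classical_sets reals.
From mathcomp Require Import complex zify.

(** There are no faces above the top dimension d, so the quadratic form of the
    Laplacian L_d is the energy x |-> |D x|^2 of the boundary map D = D_d
    ([laplacian_cdim]). The entries of D on incident pairs are signs, and a
    (d-1)-face t of B(X) lies in at most one d-face s. Hence the coordinate of
    D x at t is x_s up to sign, or 0, and nothing can cancel there
    ([free_face_energy]). Summing squares over the (d-1)-faces of B(X) and
    exchanging the sums counts each x_s^2 once for every (d-1)-face of s in
    B(X), so the part of |D x|^2 carried by B(X) is
<<
      sum over s of n_bd(s) * x_s^2          (bd_energy)
>>
    which lies between (min n_bd) |x|^2 and (max n_bd) |x|^2.

    For the lower bound, take an eigenvector x for the least eigenvalue of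
    L_d: its energy mu |x|^2 is at least the part carried by B(X). For the
    upper bound, non-vanishing relative homology gives a non-zero chain c whose
    boundary is supported on B(X), so all of |D c|^2 is carried by B(X), and
    the Rayleigh inequality mu |c|^2 <= |D c|^2 concludes. That inequality, and
    the existence of a least eigenvalue, come from the spectral theorem
    ([symmetric_min_eigenvalue], [smallest_eigenvalue_symmetric]). *)

Import Order.TTheory GRing.Theory Num.Theory.
Local Open Scope ring_scope.

(** Over the complex numbers A = P^-1 D P with P unitary and D real diagonal.
    Writing y = P x, the quadratic form of A at x is the sum of the
    D_j |y_j|^2, and |y| = |x|; so the least D_j is the constant sought. It is
    an eigenvalue of A over the reals because eigenvalues are invariant under
    field extension. *)
Lemma symmetric_min_eigenvalue {R : rcfType} {n} (A : 'M[R]_n) :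
    (0 < n)%N -> A^T = A ->
  exists2 m, eigenvalue A m &
    forall x : 'cV_n, m * (x^T *m x) 0 0 <= (x^T *m A *m x) 0 0.
Proof.
move=> n_gt0 symA; pose f : {rmorphism R -> complex R} := real_complex R.
pose AC := map_mx f A.
have hermA : AC \is hermsymmx.
  apply: realsym_hermsym; last first.
    by apply/mxOverP => i j; rewrite mxE; apply/complex_realP; exists (A i j).
  apply/is_hermitianmxP.
  by rewrite expr0 scale1r map_mx_id // /AC map_trmx symA.
pose P := spectralmx AC; pose D := spectral_diag AC.
have eqA : AC = invmx P *m diag_mx D *m P.
  by have /orthomx_spectralP := hermitian_normalmx hermA.
have P_unitary : P \is unitarymx by apply: spectral_unitarymx.
pose e j : R := complex.Re (D 0 j).
have De j : D 0 j = f (e j).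
  rewrite [RHS]RRe_real //.
  exact: (mxOverP (hermitian_spectral_diag_real hermA)).
have [j0 _ min_e] := arg_minP (i0 := Ordinal n_gt0) (P := xpredT) e isT.
exists (e j0).
  rewrite -(eigenvalue_map f) [X in eigenvalue _ X](_ : _ = D 0 j0) ?De //.
  apply/eigenvalueP; exists (row j0 P).
    rewrite -/AC eqA mulmxA -row_mul mulmxA mulmxV ?spectral_unit // mul1mx.
    by rewrite row_diag_mx De -scalemxAl -rowE.
  apply/eqP => P0; have := row_unitarymxP P_unitary j0 j0.
  by rewrite P0 eqxx linear0l => /esym/eqP; rewrite oner_eq0.
move=> x; pose y := P *m map_mx f x.
have conj_x : map_mx Num.conj (map_mx f x)^T = map_mx f x^T.
  by apply/matrixP => i j; rewrite !mxE conj_Creal //;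
     apply/complex_realP; exists (x j i).
have conj_y : (map_mx Num.conj y^T) = map_mx f x^T *m invmx P.
  by rewrite /y trmx_mul map_mxM conj_x invmx_unitary.
have toC m (B : 'M_(1, m)) (C : 'M_(m, 1)) :
    f ((B *m C) 0 0) = (map_mx f B *m map_mx f C) 0 0.
  by rewrite -map_mxM [RHS]mxE.
rewrite -lecR -!/(f _) rmorphM !toC map_mxM -/AC.
have -> : map_mx f x^T *m AC *m map_mx f x
    = map_mx Num.conj y^T *m diag_mx D *m y.
  by rewrite conj_y /y eqA !mulmxA.
have -> : map_mx f x^T *m map_mx f x = map_mx Num.conj y^T *m y.
  by rewrite conj_y /y mulmxA mulmxKV // spectral_unit.
rewrite mul_mx_diag !mxE mulr_sumr; apply: ler_sum => j _.
rewrite !mxE De [X in _ <= X]mulrAC mulrC ler_wpM2l ?lecR ?min_e //.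
by rewrite mulrC mul_conjC_ge0.
Qed.

Lemma sqnormE {R : realType} {n} (x : 'cV[R]_n) :
  (x^T *m x) 0 0 = \sum_i x i 0 ^+ 2.
Proof. by rewrite mxE; apply: eq_bigr => i _; rewrite mxE. Qed.

Lemma sqnorm_gt0 {R : realType} {n} (x : 'cV[R]_n) :
  x != 0 -> 0 < (x^T *m x) 0 0.
Proof.
rewrite sqnormE => x_neq0; rewrite lt_def sumr_ge0 ?andbT => [|i _]; last first.
  exact: sqr_ge0.
apply: contra_neq x_neq0 => /psumr_eq0P x0; apply/colP => i; rewrite mxE.
by apply/eqP; rewrite -sqrf_eq0 x0 // => j _; apply: sqr_ge0.
Qed.

(** Evaluating the Rayleigh inequality of [symmetric_min_eigenvalue] at
    eigenvectors shows that its constant bounds every eigenvalue from below, so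
    a least eigenvalue exists and is that constant. *)
Lemma smallest_eigenvalue_symmetric {R : realType} {n} (A : 'M[R]_n) :
    (0 < n)%N -> A^T = A ->
  eigenvalue A (smallest_eigenvalue A) /\
  forall x : 'cV_n,
    smallest_eigenvalue A * (x^T *m x) 0 0 <= (x^T *m A *m x) 0 0.
Proof.
move=> n_gt0 symA; have [m eig_m le_m] := symmetric_min_eigenvalue A n_gt0 symA.
have min_m b : eigenvalue A b -> m <= b.
  move=> /eigenvalueP[v vA v_neq0]; have := le_m v^T.
  rewrite trmxK vA -scalemxAl [X in _ <= X]mxE ler_pM2r //.
  by rewrite -[X in X *m _]trmxK sqnorm_gt0 // trmx_eq0.
have [eig_s min_s] : eigenvalue A (smallest_eigenvalue A) /\
    forall b, eigenvalue A b -> smallest_eigenvalue A <= b.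
  by apply: (@xgetPex _ 0 [set a | eigenvalue A a /\
    forall b, eigenvalue A b -> a <= b]%classic); exists m.
by have -> : smallest_eigenvalue A = m by apply/le_anti; rewrite min_s ?min_m.
Qed.

Lemma min_over_le {disp} {T : finOrderType disp} (S : {set {set T}}) f s :
  s \in S -> (min_over S f <= f s)%N.
Proof.
move=> Ss; rewrite /min_over; move: (\max_(t in S) f t)%N => idx.
elim: (index_enum _) (mem_index_enum s) => // t r IHr.
rewrite inE big_cons => /predU1P[<-|/IHr le_s]; first by rewrite Ss geq_minl.
by case: ifP => // _; apply: leq_trans (geq_minr _ _) le_s.
Qed.

Section Faces.

Context {R : realType} {disp : Order.disp_t} {T : finOrderType disp}.
Implicit Types (X : {set {set T}}) (s t : {set T}) (k : int).

(** If t is a codimension-one face of s, exactly one vertex v of s satisfies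
    t = s \ v, so the incidence number is a single sign; otherwise it is an
    empty sum. *)
Lemma incidence_sqr {s t} :
  Defs.dim t = Defs.dim s - 1 -> incidence R s t ^+ 2 = (t \subset s)%:R.
Proof.
rewrite /Defs.dim => dim_t; rewrite /incidence.
have [sub_ts|Nsub_ts] := boolP (t \subset s).
  have /cards1P[v ts_v] : #|s :\: t| == 1%N by rewrite cardsDS //; lia.
  have v_s : v \in s by have := set11 v; rewrite -ts_v inE => /andP[].
  have t_v : t = s :\ v.
    by rewrite -ts_v finset.setDDr finset.setDv finset.set0U;
       apply/esym/finset.setIidPr.
  rewrite (bigD1 v) ?v_s ?t_v //= big1 ?addr0 ?sqrr_sign // => w.
  move=> /andP[/andP[w_s /eqP/setP/(_ w)]]; rewrite !inE eqxx w_s andbT.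
  by move=> /negbFE ->.
rewrite big_pred0 ?expr0n // => v; apply: contraNF Nsub_ts.
by move=> /andP[_ /eqP->]; apply: subD1set.
Qed.

Lemma dim_enum_val {X k} (i : 'I_#|faces X k|) : Defs.dim (enum_val i) = k.
Proof. by have := enum_valP i; rewrite inE => /andP[_ /eqP]. Qed.

(** The sum that defines this coordinate of the boundary has at most one
    non-zero term, so squaring it produces no cross terms. *)
Lemma free_face_energy {X k} (c : 'cV[R]_#|faces X k|)
    (i : 'I_#|faces X (k - 1)|) :
    (deg X (enum_val i) <= 1)%N ->
  (bdry R X k (k - 1) *m c) i 0 ^+ 2 =
  \sum_(j < #|faces X k|) (enum_val i \subset enum_val j)%:R * c j 0 ^+ 2.
Proof.
move=> deg_i; have dim_ij (j : 'I_#|faces X k|) :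
    Defs.dim (enum_val i) = Defs.dim (enum_val j) - 1 by rewrite !dim_enum_val.
have far (j : 'I_#|faces X k|) : ~~ (enum_val i \subset enum_val j) ->
    bdry R X k (k - 1) i j = 0.
  move=> Nij; apply/eqP; rewrite -sqrf_eq0 mxE incidence_sqr //.
  by rewrite (negPf Nij).
rewrite mxE; have [/existsP[j ij]|/existsPn Nex] :=
  boolP [exists j : 'I_#|faces X k|, enum_val i \subset enum_val j]; last first.
  by rewrite !big1 ?expr0n // => j _; rewrite ?far ?(negPf (Nex j)) ?mul0r.
have unique_j (j' : 'I_#|faces X k|) :
    j' != j -> ~~ (enum_val i \subset enum_val j').
  apply: contraNN => ij'; apply/eqP/enum_val_inj.
  by apply: (card_le1_eqP deg_i);
     rewrite inE ?ij ?ij' dim_enum_val subrK enum_valP.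
rewrite (bigD1 j) //= [RHS](bigD1 j) //= !big1 ?addr0
  => [|j' /unique_j /negPf->|j' /unique_j /far->].
- by rewrite exprMn mxE incidence_sqr.
- by rewrite mul0r.
- by rewrite mul0r.
Qed.

(** The faces of B(X) of dimension d-1 are exactly those that generate it:
    such a face is contained in a generator of the same cardinality. *)
Lemma deg_bd_face {X t} :
  t \in bd_complex X -> Defs.dim t = cdim X - 1 -> (deg X t <= 1)%N.
Proof.
rewrite inE => /andP[_ /existsP[u /and3P[]]].
rewrite inE => /andP[_ /eqP dim_u] deg_u sub_tu dim_t.
suff -> : t = u by [].
by apply/eqP; rewrite eqEcard sub_tu; move: dim_t dim_u; rewrite /Defs.dim; lia.
Qed.

Lemma faces_above_cdim X : faces X (cdim X + 1) = finset.set0.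
Proof.
apply/setP => s; rewrite !inE; apply/negbTE/andP => -[Xs].
have := @leq_bigmax_cond _ (mem X) (fun u : {set T} => #|u|) s Xs.
by rewrite /Defs.dim /cdim /=; lia.
Qed.

Lemma laplacian_cdim X :
  laplacian R X (cdim X) =
  (bdry R X (cdim X) (cdim X - 1))^T *m bdry R X (cdim X) (cdim X - 1).
Proof.
rewrite /laplacian; set M := bdry R X (cdim X + 1) _.
suff -> : M *m M^T = 0 by rewrite add0r.
apply/matrixP => i j; rewrite !mxE big1 // => k.
by have /setP/(_ (enum_val k)) := faces_above_cdim X; rewrite enum_valP inE.
Qed.

(** The double counting behind both bounds: exchange the sums over the
    (d-1)-faces of B(X) and over the d-faces that contain them. *)
Lemma bd_energy X (c : 'cV[R]_#|faces X (cdim X)|) :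
  let n_bd s := #|boundary_faces X s :&: faces (bd_complex X) (cdim X - 1)| in
  \sum_(i | enum_val i \in bd_complex X)
      (bdry R X (cdim X) (cdim X - 1) *m c) i 0 ^+ 2 =
  \sum_j (n_bd (enum_val j))%:R * c j 0 ^+ 2.
Proof.
move=> n_bd; pose B := bd_complex X.
rewrite (eq_bigr (fun i : 'I_#|faces X (cdim X - 1)| =>
    \sum_(j < #|faces X (cdim X)|)
    (enum_val i \subset enum_val j)%:R * c j 0 ^+ 2)) => [|i Bi]; last first.
  by apply: free_face_energy; apply: deg_bd_face Bi _; apply: dim_enum_val.
rewrite exchange_big; apply: eq_bigr => j _; rewrite -mulr_suml; congr (_ * _).
rewrite -(big_enum_val_cond (mem B) (fun t => (t \subset enum_val j)%:R)) /=.
rewrite /n_bd -sum1_card natr_sum [RHS]big_mkcond [LHS]big_mkcond.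
apply: eq_bigr => t _; rewrite /boundary_faces !inE dim_enum_val.
by case: (t \in X); case: (Defs.dim t == _);
  case: (t \subset enum_val j) => //=; case: [exists _ in _, _].
Qed.

End Faces.

Theorem theorem1p13 (R : realType) (disp : Order.disp_t)
    (T : finOrderType disp) (X : {set {set T}}) (d : int)
    (hX : simplicial_complex X) (hdim : cdim X = d) (hpure : pure X)
    (hH : rel_homology_neq0 R X (bd_complex X) d) :
  let n_bd s := #|boundary_faces X s :&: faces (bd_complex X) (d - 1)| in
  (min_over (faces X d) n_bd)%:R <= mu R X d /\
  mu R X d <= (\max_(s in faces X d) n_bd s)%N%:R.
Proof.
subst d; move=> n_bd; have [c [cycle_c not_bd_c]] := hH.
have c_neq0 : c != 0.
  (* The zero chain is the boundary of 0, hence a relative boundary. *)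
  apply: contra_notN not_bd_c => /eqP->; exists 0 => i _.
  by rewrite mulmx0 subr0 mxE.
set D := bdry R X (cdim X) (cdim X - 1) in cycle_c *.
have n_gt0 : (0 < #|faces X (cdim X)|)%N.
  rewrite lt0n; apply: contra_neqN c_neq0 => /eqP n0; apply/colP => i.
  by have := ltn_ord i; rewrite [X in (_ < X)%N]n0.
have energy (x : 'cV_#|faces X (cdim X)|) :
    (x^T *m laplacian R X (cdim X) *m x) 0 0 = \sum_i (D *m x) i 0 ^+ 2.
  by rewrite laplacian_cdim -sqnormE trmx_mul !mulmxA.
have symL : (laplacian R X (cdim X))^T = laplacian R X (cdim X).
  by rewrite laplacian_cdim trmx_mul trmxK.
have [/eigenvalueP[v vL v_neq0] le_mu] :=
  smallest_eigenvalue_symmetric _ n_gt0 symL.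
rewrite -/(mu R X (cdim X)) in vL le_mu; split.
  have x_neq0 : v^T != 0 by rewrite trmx_eq0.
  rewrite -(ler_pM2r (sqnorm_gt0 _ x_neq0)); have := energy v^T.
  rewrite trmxK vL -scalemxAl mxE => ->.
  rewrite (bigID (fun i => enum_val i \in bd_complex X)) /= bd_energy.
  rewrite -[v in v *m _]trmxK sqnormE mulr_sumr.
  (* Discard the energy carried by the faces outside B(X). *)
  rewrite -[leLHS]addr0 lerD ?sumr_ge0 // => [|i _]; last exact: sqr_ge0.
  apply: ler_sum => j _; rewrite ler_wpM2r ?sqr_ge0 // ler_nat.
  exact/min_over_le/enum_valP.
rewrite -(ler_pM2r (sqnorm_gt0 _ c_neq0)); apply: le_trans (le_mu c) _.
rewrite energy (bigID (fun i => enum_val i \in bd_complex X)) /= bd_energy.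
(* A relative cycle carries no energy outside B(X). *)
rewrite [X in _ + X]big1 ?addr0 => [|i /cycle_c ->]; last by rewrite expr0n.
rewrite sqnormE mulr_sumr; apply: ler_sum => j _.
rewrite ler_wpM2r ?sqr_ge0 // ler_nat.
exact: (@leq_bigmax_cond _ (mem (faces X (cdim X))) n_bd _ (enum_valP j)).
Qed.
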